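(* Let $P\subset\mathbb{R}^n$ be a polytope positively oriented by $\vec v\in\mathbb{R}^n$. For each hyperplane $H$ of the fundamental hyperplane arrangement $\mathcal{H}_P$ choose a normal vector $\vec d_H$ of $H$ with $\langle \vec d_H,\vec v\rangle>0$. Let $F,G$ be nonempty faces of $P$, and let $\{\vec F_i\}_i$ (resp. $\{\vec G_j\}_j$) be a family consisting of one outward pointing normal vector for each facet of $P$ containing $F$ (resp. $G$). Then the following are equivalent: (0) $(F,G)\in \operatorname{Im}\triangle_{(P,\vec v)}$; (1) for all $H\in\mathcal{H}_P(F,G)$, there is an $i$ with $\langle \vec F_i,\vec d_H\rangle<0$ or there is a $j$ with $\langle \vec G_j,\vec d_H\rangle>0$; (2) for all $H\in\mathcal{H}_P$, there is an $i$ with $\langle \vec F_i,\vec d_H\rangle<0$ or there is a $j$ with $\langle \vec G_j,\vec d_H\rangle>0$.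
   Context: A polytope is the convex hull of a finite nonempty subset of $\mathbb{R}^n$. For $z\in P$ put $\rho_zP=2z-P$. The polytope $P$ is positively oriented by $\vec v$ if for every $z\in P$ the vector $\vec v$ is not perpendicular to any edge of $P\cap\rho_zP$. The fundamental hyperplane arrangement $\mathcal{H}_P$ is the collection of all linear hyperplanes of $\mathbb{R}^n$ orthogonal to the direction of an edge of $P\cap\rho_zP$, for some $z\in P$. Bot-top diagonal: for $(P,\vec v)$ positively oriented, the linear form $\langle -,\vec v\rangle$ has, on each $P\cap\rho_zP$, a unique minimizer $\operatorname{bot}(P\cap\rho_zP)$ and a unique maximizer $\operatorname{top}(P\cap\rho_zP)$, and $\triangle_{(P,\vec v)}:P\to P\times P$ is the map $z\mapsto(\operatorname{bot}(P\cap\rho_zP),\operatorname{top}(P\cap\rho_zP))$. Its image is a union of faces $F\times G$ of $P\times P$; ''$(F,G)\in\operatorname{Im}\triangle_{(P,\vec v)}$'' means $F\times G\subset\operatorname{Im}\triangle_{(P,\vec v)}$. A vector $\vec d$ is an outward pointing normal vector for a facet (codimension one face) $E$ of $P$ if for some $c\in\mathbb{R}$ the hyperplane $\{x:\langle\vec d,x\rangle=c\}$ meets $P$ exactly in $E$ and no point $x\in P$ has $\langle \vec d,x\rangle>c$. The normal cone of a nonempty face $F$ is $\mathcal{N}_P(F)=\{c\in\mathbb{R}^n: F\subseteq\{x\in P:\langle c,x\rangle=\max_{y\in P}\langle c,y\rangle\}\}$. $\operatorname{Cone}(X)$ denotes the set of nonnegative linear combinations of elements of $X$. $\mathcal{H}_P(F,G)$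 is the set of $H\in\mathcal{H}_P$ that intersect the interior of a codimension 1 face of the cone $\operatorname{Cone}(-\mathcal{N}_P(F)\cup\mathcal{N}_P(G))$.
   Formalization: If Cone(−N_P(F) ∪ N_P(G)) is a proper linear subspace it has no codimension 1 face, so (1) is vacuous while (0) and (2) fail (e.g. P a square, F = G = P); here, in that case only, the cone counts as its own codimension 1 face in the definition of H_P(F,G). *)

(* Defs.v *)
From mathcomp Require Import all_boot all_order all_algebra.
From mathcomp Require Import all_classical all_reals all_analysis.

Set Implicit Arguments.
Unset Strict Implicit.
Unset Printing Implicit Defensive.

Import Order.TTheory GRing.Theory Num.Theory.
Import numFieldNormedType.Exports.

Local Open Scope classical_set_scope.
Local Open Scope ring_scope.

Section Defs.
Context {R : realType} {n : nat}.
Implicit Types (P Q F G E X H : set 'rV[R]_n) (c d v x y z : 'rV[R]_n).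

Definition dot x y : R := \sum_(i < n) x 0 i * y 0 i.

Definition convex_hull X : set 'rV[R]_n :=
  [set x | exists (k : nat) (p : 'I_k -> 'rV[R]_n) (w : 'I_k -> R),
     [/\ forall i, X (p i), forall i, 0 <= w i, \sum_i w i = 1
       & x = \sum_i w i *: p i]].

Definition affine_hull X : set 'rV[R]_n :=
  [set x | exists (k : nat) (p : 'I_k -> 'rV[R]_n) (w : 'I_k -> R),
     [/\ forall i, X (p i), \sum_i w i = 1 & x = \sum_i w i *: p i]].

Definition Cone X : set 'rV[R]_n :=
  [set x | exists (k : nat) (p : 'I_k -> 'rV[R]_n) (w : 'I_k -> R),
     [/\ forall i, X (p i), forall i, 0 <= w i & x = \sum_i w i *: p i]].

Definition polytope P : Prop :=
  exists A : set 'rV[R]_n, [/\ finite_set A, A !=set0 & P = convex_hull A].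

(* The largest k such that X contains k + 1 affinely independent points
   x, x + row 0 Y, ..., x + row (k - 1) Y.  Only meaningful for X nonempty:
   the empty set gets 0. *)
Definition affdim X : nat :=
  \max_(k < n.+1 | `[< exists x (Y : 'M[R]_(k, n)),
     [/\ X x, forall i, X (x + row i Y) & row_free Y] >]) k.

Definition relint X : set 'rV[R]_n :=
  [set x | X x /\ within (affine_hull X) (nbhs x) X].

Definition argmax Q c : set 'rV[R]_n :=
  [set x | Q x /\ forall y, Q y -> dot c y <= dot c x].

(* Nonempty faces, Q itself (c = 0) included.  Applied to polytopes and to
   polyhedral cones; for a cone Q, argmax Q c is nonempty exactly when
   dot c <= 0 on Q. *)
Definition face Q F : Prop := F !=set0 /\ exists c, F = argmax Q c.

Definition facet Q E : Prop := face Q E /\ (affdim E).+1 = affdim Q.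

Definition edge Q E : Prop := face Q E /\ affdim E = 1.

Definition edge_direction Q d : Prop :=
  exists E x y, [/\ edge Q E, E x, E y, x <> y & d = x - y].

Definition reflection z P : set 'rV[R]_n := [set 2%:R *: z - y | y in P].

Definition positively_oriented P v : Prop :=
  forall z, P z ->
  forall d, edge_direction (P `&` reflection z P) d -> dot d v <> 0.

(* The minimizer and maximizer are unique when Q = P `&` reflection z P, with
   P z and P positively oriented by v; 0 is a dummy default. *)
Definition bot Q v : 'rV[R]_n := xget 0 (argmax Q (- v)).
Definition top Q v : 'rV[R]_n := xget 0 (argmax Q v).

Definition diagonal P v z : 'rV[R]_n * 'rV[R]_n :=
  (bot (P `&` reflection z P) v, top (P `&` reflection z P) v).

Definition in_im_diagonal P v F G : Prop := F `*` G `<=` diagonal P v @` P.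

Definition outward_normal P E d : Prop :=
  exists2 c : R, P `&` [set x | dot d x = c] = E
               & forall x, P x -> dot d x <= c.

Definition hyperplane d : set 'rV[R]_n := [set x | dot d x = 0].

Definition normal_vector H d : Prop := d <> 0 /\ H = hyperplane d.

Definition fundamental_arrangement P : set (set 'rV[R]_n) :=
  [set H | exists z d, [/\ P z, edge_direction (P `&` reflection z P) d
                         & H = hyperplane d]].

Definition normal_cone P F : set 'rV[R]_n := [set c | F `<=` argmax P c].

Definition pair_cone P F G : set 'rV[R]_n :=
  Cone ([set - c | c in normal_cone P F] `|` normal_cone P G).

(* The codimension 1 faces of a convex cone C, with the convention that a
   proper linear subspace, which has no proper face, is its own wall.  If
   F = G is a face of P of positive dimension, then pair_cone P F F is the
   linear span of normal_cone P F, a proper subspace; with no wall at all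
   there, no hyperplane would be selected in arrangement_at P F F, although
   (F, F) is not in the image of the diagonal. *)
Definition wall C E : Prop :=
  facet C E \/
  [/\ E = C, forall x, C x -> C (- x) & C <> [set: 'rV[R]_n]].

Definition arrangement_at P F G : set (set 'rV[R]_n) :=
  [set H | fundamental_arrangement P H /\
     exists2 E, wall (pair_cone P F G) E & H `&` relint E !=set0].

End Defs.

(* Main.v *)
(* Idea. For x in the relative interior of F, y in that of G and
   z = (x + y) / 2, the point y maximizes v on Q = P `&` (2 z - P) iff v lies in
   C = N_P(G) - N_P(F), so (0) says that v is in C. If v = g - f is in C, the
   sign condition at H follows from dot g (d H) > 0 or dot f (d H) < 0, since
   normal cones are generated, up to lineality, by facet normals. If v is not
   in C, let K be the polar cone of C, i.e. the cone of feasible directions of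
   Q at y. If K is pointed, it has an extreme ray e with dot v e > 0, which is
   an edge of Q at y and whose orthogonal cuts C in a facet. Otherwise the face
   of Q through y has an edge in the lineality space of K, whose orthogonal
   contains C, hence every wall of C. *)
Require Import Defs.
From mathcomp Require Import all_boot all_order all_algebra.
From mathcomp Require Import all_classical all_reals all_analysis.
From mathcomp Require Import ring lra.

Import Order.TTheory GRing.Theory Num.Theory.
Import numFieldNormedType.Exports.

Local Open Scope classical_set_scope.
Local Open Scope ring_scope.

Set Implicit Arguments.
Unset Strict Implicit.
Unset Printing Implicit Defensive.

(** $P$ need not be full-dimensional. Forms constant on $P$ then lie in every normal cone, and an
    outward normal of a facet is determined only up to such forms and a positive factor. Hence
    vertices and extreme rays are replaced by notions modulo lineality, and the sign of an outward
    normal at $u$ is controlled only for $u$ parallel to the affine hull of $P$. Each [d H]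
    qualifies, being a multiple of a difference of two points of $P$. The generation of normal cones
    by facet normals enters only through single rays: if some $c$ in the cone has positive product
    with $u$, so does an extreme ray. Both descriptions of polytopes are needed. Generators $a_i$
    give the feasible directions at $y$ as the cone of the $a_i-y$, and the normal cone as its
    polar; maximizers and edges of $Q$ are found from inequalities, since generators do not pass to
    intersections. *)

Section Dot.
Context {R : realType} {n : nat}.
Implicit Types x y z : 'rV[R]_n.

Lemma dotC x y : dot x y = dot y x.
Proof. by apply: eq_bigr => i _; rewrite mulrC. Qed.

Lemma dotDl x y z : dot (x + y) z = dot x z + dot y z.
Proof. by rewrite -big_split; apply: eq_bigr => i _; rewrite mxE mulrDl. Qed.

Lemma dotZl t x y : dot (t *: x) y = t * dot x y.
Proof. by rewrite mulr_sumr; apply: eq_bigr => i _; rewrite mxE mulrA. Qed.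

Lemma dotNl x y : dot (- x) y = - dot x y.
Proof. by rewrite -scaleN1r dotZl mulN1r. Qed.

Lemma dot0l x : dot 0 x = 0.
Proof. by rewrite -(scale0r x) dotZl mul0r. Qed.

Lemma dotDr x y z : dot x (y + z) = dot x y + dot x z.
Proof. by rewrite dotC dotDl !(dotC x). Qed.

Lemma dotZr t x y : dot x (t *: y) = t * dot x y.
Proof. by rewrite dotC dotZl dotC. Qed.

Lemma dotNr x y : dot x (- y) = - dot x y.
Proof. by rewrite dotC dotNl dotC. Qed.

Lemma dot0r x : dot x 0 = 0.
Proof. by rewrite dotC dot0l. Qed.

Definition dotE := (dotDl, dotDr, dotNl, dotNr, dotZl, dotZr, dot0l, dot0r).

Lemma dot_suml (I : Type) (r : seq I) (p : pred I) (f : I -> 'rV[R]_n) x :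
  dot (\sum_(i <- r | p i) f i) x = \sum_(i <- r | p i) dot (f i) x.
Proof. by apply: (big_morph (dot^~ x)) => [y z|]; rewrite ?dotDl ?dot0l. Qed.

Lemma dot_sumr (I : Type) (r : seq I) (p : pred I) (f : I -> 'rV[R]_n) x :
  dot x (\sum_(i <- r | p i) f i) = \sum_(i <- r | p i) dot x (f i).
Proof. by rewrite dotC dot_suml; apply: eq_bigr => i _; rewrite dotC. Qed.

Lemma dotxx_ge0 x : 0 <= dot x x.
Proof. by apply: sumr_ge0 => i _; rewrite -expr2 sqr_ge0. Qed.

Lemma dotxx_eq0 x : (dot x x == 0) = (x == 0).
Proof.
apply/eqP/eqP => [x0|->]; last exact: dot0l.
apply/rowP => i; rewrite mxE; apply/eqP; rewrite -sqrf_eq0 expr2; apply/eqP.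
by apply: (psumr_eq0P _ x0) => // j _; rewrite -expr2 sqr_ge0.
Qed.

Lemma dotxx_gt0 x : (0 < dot x x) = (x != 0).
Proof. by rewrite lt0r dotxx_eq0 dotxx_ge0 andbT. Qed.

End Dot.

(** * Basic points, extreme rays and the Farkas lemma *)

Section Polyhedra.
Context {R : realType} {n : nat}.
Implicit Types (u v w x y : 'rV[R]_n) (I J : finType).

Definition gen I (g : I -> 'rV[R]_n) : set 'rV[R]_n :=
  [set x | exists2 w : I -> R, (forall i, 0 <= w i) & x = \sum_i w i *: g i].

Definition polar I (g : I -> 'rV[R]_n) : set 'rV[R]_n :=
  [set u | forall i, dot (g i) u <= 0].

Definition polyhedron I (h : I -> 'rV[R]_n) (b : I -> R) : set 'rV[R]_n :=
  [set w | forall i, dot (h i) w <= b i].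

Lemma gen_elt I (g : I -> 'rV[R]_n) i : gen g (g i).
Proof.
exists (fun j => (j == i)%:R) => [j|]; first by rewrite ler0n.
rewrite (bigD1 i) //= eqxx scale1r big1 ?addr0 // => j /negbTE->.
by rewrite scale0r.
Qed.

Lemma gen0 I (g : I -> 'rV[R]_n) : gen g 0.
Proof.
by exists (fun=> 0) => //; rewrite big1 // => i _; rewrite scale0r.
Qed.

Lemma polar_gen I (g : I -> 'rV[R]_n) u x :
  polar g u -> gen g x -> dot x u <= 0.
Proof.
move=> gu [w w0 ->]; rewrite dot_suml; apply: sumr_le0 => i _.
by rewrite dotZl mulr_ge0_le0.
Qed.

(** The step [t] is the least ratio of slack to slope over the positive slopes; the minimizing
    constraint is the one that becomes tight. *)
Lemma ratio_test I (slack slope : I -> R) :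
  (forall i, 0 <= slack i) -> (exists i, 0 < slope i) ->
  exists t i, [/\ 0 <= t, forall j, t * slope j <= slack j,
    0 < slope i & t * slope i = slack i].
Proof.
move=> slack0 [i0 i0P].
case: (@arg_minP _ _ _ i0 (fun i => 0 < slope i) (fun i => slack i / slope i) i0P).
move=> i iP imin; exists (slack i / slope i), i; split => //.
- by rewrite divr_ge0 // ltW.
- move=> j; case: (ltP 0 (slope j)) => [jP|jN].
    by rewrite -ler_pdivlMr // imin.
  by rewrite (le_trans _ (slack0 j)) // mulr_ge0_le0 // divr_ge0 // ltW.
- by rewrite divfK // gt_eqF.
Qed.

(** Simplex-like descent on the number of slack rows: while some [u] is orthogonal to the tight rows
    but not to all rows, a move along it keeps the tight rows tight and tightens one more. The
    conclusion says that the tight rows span all rows, so [y'] is a vertex up to lineality. *)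
Lemma basic_point I (h : I -> 'rV[R]_n) (b : I -> R) v y :
    (forall u, 0 < dot v u -> exists i, 0 < dot (h i) u) ->
    polyhedron h b y ->
  exists y', [/\ polyhedron h b y', dot v y <= dot v y' &
    forall u, (forall i, dot (h i) y' = b i -> dot (h i) u = 0) ->
      forall i, dot (h i) u = 0].
Proof.
move=> bnd; have [m] := ubnP #|[set i | dot (h i) y != b i]%SET|.
elim: m y => // m IHm y cardy hy.
have [?|/existsNP [u /not_implyP [uP /existsNP [i /eqP iP]]]] := pselect (forall u,
  (forall i, dot (h i) y = b i -> dot (h i) u = 0) -> forall i, dot (h i) u = 0).
  by exists y.
(* The sign of [u] is chosen so that [v] does not decrease and some row increases. The second demand
   follows from [bnd] if [v] increases, and is met by choice of sign if [v] is constant along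
   [u]. *)
have {i iP} [u' [u'P vu' posu']] : exists u',
    [/\ forall i, dot (h i) y = b i -> dot (h i) u' = 0, 0 <= dot v u' &
        exists i, 0 < dot (h i) u'].
  case: (ltgtP (dot v u) 0) => vu.
  - exists (- u); split => [j /uP ju||]; rewrite ?dotNr ?ju ?oppr0 ?oppr_ge0 //.
      exact: ltW.
    by apply: bnd; rewrite dotNr oppr_gt0.
  - by exists u; split => //; [exact: ltW | exact: bnd].
  - case: (ltgtP (dot (h i) u) 0) iP => // iu _.
      exists (- u); split => [j /uP ju||]; rewrite ?dotNr ?ju ?oppr0 ?vu ?oppr0 //.
      by exists i; rewrite dotNr oppr_gt0.
    by exists u; split; rewrite ?vu //; exists i.
have [t [k [t0 tP kP tk]]] :=
  @ratio_test _ (fun i => b i - dot (h i) y) (fun i => dot (h i) u')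
    (fun i => etrans (subr_ge0 _ _) (hy i)) posu'.
have [|i|y' [hy' vy' y'P]] := IHm (y + t *: u').
- rewrite (leq_trans _ (_ : #|[set i | dot (h i) y != b i]%SET| <= m)%N) //.
  apply: proper_card; apply/properP; split.
    apply/fintype.subsetP => j; rewrite !inE; apply: contra => /eqP jP.
    by rewrite !dotE jP u'P // mulr0 addr0.
  exists k; rewrite !inE.
    by apply/eqP => /u'P; move: kP => /[swap] ->; rewrite ltxx.
  by rewrite !dotE tk addrC subrK eqxx.
- by rewrite !dotE; have := tP i; lra.
- exists y'; split => //; apply: le_trans vy'; rewrite !dotE lerDl.
  by rewrite mulr_ge0.
Qed.

(** The tight set of a basic point determines its value under [v]: the difference of two basic
    points with equal tight sets is orthogonal to all rows, so [bnd] forbids an increase. Finitely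
    many tight sets remain to compare. *)
Lemma argmax_nonempty I (h : I -> 'rV[R]_n) (b : I -> R) v :
    (forall u, 0 < dot v u -> exists i, 0 < dot (h i) u) ->
  polyhedron h b !=set0 -> argmax (polyhedron h b) v !=set0.
Proof.
move=> bnd [y0 y0P].
pose tight y := [set i | dot (h i) y == b i]%SET.
pose basic y := polyhedron h b y /\
  forall u, (forall i, dot (h i) y = b i -> dot (h i) u = 0) ->
    forall i, dot (h i) u = 0.
have basic_le y y' : basic y -> basic y' -> tight y = tight y' ->
    dot v y <= dot v y'.
  move=> [_ yP] _ yy'; rewrite leNgt; apply/negP => lt.
  have [|i] := bnd (y - y'); first by rewrite !dotE subr_gt0.
  rewrite yP ?ltxx // => j jy; rewrite !dotE jy.
  have : j \in tight y by rewrite inE jy.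
  by rewrite yy' inE => /eqP ->; rewrite subrr.
pose repr S := xget y0 [set y | basic y /\ tight y = S].
have reprP y : basic y -> basic (repr (tight y)) /\ tight (repr (tight y)) = tight y.
  by move=> yP; rewrite /repr; case: xgetP => [x _ []|/(_ y) []].
have [y1 [y1P _ y1b]] := basic_point bnd y0P.
have y1B : basic y1 by split.
pose S0 := tight y1.
have S0P : `[< exists2 y, basic y & tight y = S0 >] by apply/asboolP; exists y1.
case: (@arg_maxP _ _ _ S0 (fun S => `[< exists2 y, basic y & tight y = S >])
  (fun S => dot v (repr S)) S0P) => S /asboolP [yS ySB <-] Smax.
have [[Q1 _] _] := reprP _ ySB.
exists (repr (tight yS)); split => // y yP.
have [y' [y'P le y'b]] := basic_point bnd yP.
have y'B : basic y' by split.
have [y'B2 y't] := reprP _ y'B.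
apply: (le_trans le); apply: le_trans (basic_le _ _ y'B y'B2 (esym y't)) _.
by apply: Smax; apply/asboolP; exists y'.
Qed.

(* The slice of the polar cone by the hyperplane [dot v = 1] has a basic
   point [e]. *)
Lemma extreme_ray I (g : I -> 'rV[R]_n) v u :
    polar g u -> 0 < dot v u ->
  exists e, [/\ polar g e, dot v e = 1 &
    forall w, (forall i, dot (g i) e = 0 -> dot (g i) w = 0) ->
      forall i, dot (g i) (w - dot v w *: e) = 0].
Proof.
move=> gu vu.
(* The rows [v] and [- v] with bounds 1 and -1 encode the slice; the objective 0 makes the
   boundedness premise of [basic_point] vacuous. *)
pose h (i : option (option I)) :=
  if i is Some j then if j is Some k then g k else v else - v.
pose b (i : option (option I)) : R :=
  if i is Some j then if j is Some k then 0 else 1 else -1.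
have [||e [eP _ eb]] := @basic_point _ h b 0 ((dot v u)^-1 *: u).
- by move=> w; rewrite dot0l ltxx.
- move=> [[i|]|] /=; rewrite !dotE ?mulVf ?gt_eqF //.
  by rewrite mulr_ge0_le0 // invr_ge0 ltW.
have ve : dot v e = 1.
  apply/eqP; rewrite eq_le (eP (Some None)) /=.
  by have := eP None; rewrite /= dotNl lerN2.
exists e; split => // [i|w wP i]; first exact: (eP (Some (Some i))).
apply: (eb _ _ (Some (Some i))) => -[[j|]|] /= je; rewrite !dotE ?ve ?je.
- by rewrite wP //; ring.
- by ring.
- by ring.
Qed.

(** If the premise fails without [g ord0], a witness [u] has positive product with [g ord0].
    Subtracting multiples of [g ord0] then moves all vectors into the hyperplane orthogonal to [u],
    with one generator fewer. *)
Lemma farkas_ord m (g : 'I_m -> 'rV[R]_n) c :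
  (forall u, polar g u -> dot c u <= 0) -> gen g c.
Proof.
elim: m g c => [|m IHm] g c gc.
  exists (fun=> 0) => //; rewrite big_ord0; apply/eqP.
  rewrite -dotxx_eq0 eq_le dotxx_ge0 andbT; by apply: gc => -[].
pose g' (i : 'I_m) := g (lift ord0 i).
have extend t (w : 'I_m -> R) : 0 <= t -> (forall i, 0 <= w i) ->
    gen g (t *: g ord0 + \sum_i w i *: g' i).
  move=> t0 w0; exists (fun i => oapp w t (unlift ord0 i)) => [i|].
    by rewrite /=; case: (unlift ord0 i).
  by rewrite big_ord_recl unlift_none; congr (_ + _);
    apply: eq_bigr => i _; rewrite liftK.
have [/IHm [w w0 ->]|/existsNP [u /not_implyP [gu /negP]]] :=
  pselect (forall u, polar g' u -> dot c u <= 0).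
  by have := extend 0 w (lexx _) w0; rewrite scale0r add0r.
rewrite -ltNge => cu.
have g0u : 0 < dot (g ord0) u.
  rewrite ltNge; apply/negP => g0u; move: cu; rewrite ltNge gc // => i.
  by case: (unliftP ord0 i) => [j ->|->] //; exact: gu.
pose s x := dot x u / dot (g ord0) u.
(* The adjoint of this projection moves [x] along [u] until it is orthogonal to [g ord0], whose
   constraint then holds trivially. *)
have sE a x : dot (a - s a *: g ord0) x =
    dot a (x - (dot (g ord0) x / dot (g ord0) u) *: u).
  by rewrite /s !dotE; ring.
have [|w w0 cE] := IHm (fun i => g' i - s (g' i) *: g ord0) (c - s c *: g ord0).
  move=> x xP; rewrite sE; apply: gc => i.
  case: (unliftP ord0 i) => [j ->|->]; first by have := xP j; rewrite sE.
  by rewrite !dotE divfK ?gt_eqF // subrr.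
(* The coefficient of [g ord0] is nonnegative since [s c] is positive and every [s (g' i)] is at
   most 0. *)
suff -> : c = (s c - \sum_i w i * s (g' i)) *: g ord0 + \sum_i w i *: g' i.
  apply: extend => //; rewrite subr_ge0; apply: (@le_trans _ _ 0).
    apply: sumr_le0 => i _; rewrite mulr_ge0_le0 // mulr_le0_ge0 //.
    by rewrite invr_ge0 ltW.
  by rewrite divr_ge0 ?ltW.
apply/eqP; rewrite scalerBl addrAC -addrA addrC -subr_eq cE scaler_suml -sumrB.
by apply/eqP/eq_bigr => i _; rewrite scalerBr scalerA.
Qed.

Lemma farkas I (g : I -> 'rV[R]_n) c :
  (forall u, polar g u -> dot c u <= 0) -> gen g c.
Proof.
move=> gc; have [|w w0 ->] := @farkas_ord _ (fun i : 'I_#|I| => g (enum_val i)) c.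
  move=> u uP; apply: gc => i; have := uP (enum_rank i); by rewrite enum_rankK.
exists (fun i => w (enum_rank i)) => //.
rewrite (reindex (@enum_rank I)) /=; last exact/onW_bij/enum_rank_bij.
by apply: eq_bigr => i _; rewrite enum_rankK.
Qed.

Lemma farkasN I (g : I -> 'rV[R]_n) c :
  ~ gen g c -> exists2 u, polar g u & 0 < dot c u.
Proof.
move=> gc; have /existsNP [u /not_implyP [gu /negP]] :
  ~ forall u, polar g u -> dot c u <= 0 by move=> /farkas.
by rewrite -ltNge; exists u.
Qed.

End Polyhedra.

(** * Finitely generated cones: double description, ranks and facets *)

Section Generators.
Context {R : realType} {n : nat}.
Implicit Types (u v w x y e : 'rV[R]_n) (I J : finType).

Lemma genD I (g : I -> 'rV[R]_n) x y : gen g x -> gen g y -> gen g (x + y).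
Proof.
move=> [w w0 ->] [w' w'0 ->]; exists (w \+ w') => [i|]; first by rewrite addr_ge0.
by rewrite -big_split; apply: eq_bigr => i _; rewrite scalerDl.
Qed.

Lemma genZ I (g : I -> 'rV[R]_n) t x : 0 <= t -> gen g x -> gen g (t *: x).
Proof.
move=> t0 [w w0 ->]; exists (fun i => t * w i) => [i|]; first by rewrite mulr_ge0.
by rewrite scaler_sumr; apply: eq_bigr => i _; rewrite scalerA.
Qed.

Lemma gen_sum I J (g : I -> 'rV[R]_n) (f : J -> 'rV[R]_n) :
  (forall j, gen g (f j)) -> gen g (\sum_j f j).
Proof. by move=> gf; apply: big_ind => //; [exact: gen0 | exact: genD]. Qed.

Lemma gen_sub I J (g : I -> 'rV[R]_n) (f : J -> 'rV[R]_n) :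
  (forall j, gen g (f j)) -> gen f `<=` gen g.
Proof. by move=> gf _ [w w0 ->]; apply: gen_sum => j; apply: genZ. Qed.

(* Double description: intersecting [gen g] with the half-space [dot b <= 0]
   keeps the generators inside it and adds a combination lying on the boundary
   for each pair of generators on opposite sides. *)
Lemma weyl_seq (s : seq 'rV[R]_n) :
  exists J (g : J -> 'rV[R]_n), [set u | forall b, b \in s -> dot b u <= 0] = gen g.
Proof.
elim: s => [|b s [J [g IHs]]].
  exists (bool * 'I_n)%type, (fun p : bool * 'I_n => (-1) ^+ p.1 *: delta_mx 0 p.2 : 'rV[R]_n).
  apply/seteqP; split => // x _; apply: farkas => u uP.
  suff -> : u = 0 by rewrite dot0r.
  apply/rowP => i; rewrite mxE; apply/eqP; rewrite eq_le.
  have dlt c : dot (c *: delta_mx 0 i) u = c * u 0 i.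
    rewrite dotZl /dot (bigD1 i) //= mxE !eqxx mul1r big1 ?addr0 // => j /negbTE ji.
    by rewrite mxE ji andbF mul0r.
  have := uP (false, i); have := uP (true, i); rewrite !dlt expr0 expr1.
  by rewrite mulN1r oppr_le0 mul1r => -> ->.
pose bt j := dot b (g j).
pose g' (k : J + J * J) := match k with
  | inl k => if bt k <= 0 then g k else 0
  | inr (k, l) => if (0 < bt k) && (bt l < 0) then bt k *: g l - bt l *: g k else 0
  end.
exists (J + J * J)%type, g'; apply/seteqP; split => [x xP|x xg'].
  have : gen g x by rewrite -IHs => c cs; apply: xP; rewrite inE cs orbT.
  move=> xg; have bx : dot b x <= 0 by apply: xP; rewrite inE eqxx.
  apply: farkas => u ug'.
  (* It suffices that [u - t *: b] be polar to [g], because [dot b x <= 0]. For [t] serves the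
     largest ratio of [dot (g k) u] to [bt k] over [bt k > 0], or 0 if none is positive; the mixed
     generators compare it with the indices where [bt] is negative. *)
  suff [t t0 tP] : exists2 t, 0 <= t & forall k, dot (g k) u <= t * bt k.
    have := @polar_gen _ _ _ g (u - t *: b) x.
    rewrite !dotE => H; have := mulr_ge0_le0 t0 bx; rewrite (dotC b) => tb.
    suff : dot x u - t * dot x b <= 0 by move: tb; lra.
    by apply: H => // k; rewrite !dotE subr_le0 (dotC (g k) b); exact: tP.
  have neg k : bt k <= 0 -> dot (g k) u <= 0.
    by move=> k0; have := ug' (inl k); rewrite /= k0.
  have pair k l : 0 < bt k -> bt l < 0 -> bt k * dot (g l) u <= bt l * dot (g k) u.
    by move=> k0 l0; have := ug' (inr (k, l)); rewrite /= k0 l0 !dotE subr_le0.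
  have [[k0 /andP[k0P k0u]]|/forallNP none] :=
    pselect (exists k, (0 < bt k) && (0 < dot (g k) u)).
    case: (@arg_maxP _ _ _ k0 (fun k => 0 < bt k) (fun k => dot (g k) u / bt k) k0P).
    move=> k kP kmax; set t := dot (g k) u / bt k.
    have t0 : 0 < t.
      apply: lt_le_trans (kmax _ k0P); exact: divr_gt0.
    exists t => [|l]; first exact: ltW.
    case: (ltgtP (bt l) 0) => lP.
    - by rewrite /t mulrAC ler_pdivlMr // mulrC (mulrC _ (bt l)) pair.
    - by rewrite -ler_pdivrMr //; exact: kmax.
    - by rewrite lP mulr0 neg // lP.
  exists 0 => // k; rewrite mul0r; case: (leP (bt k) 0) => [/neg //|kP].
  by rewrite leNgt; apply/negP => ku; apply: (none k); rewrite kP.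
have {}IHs c : c \in s -> dot c x <= 0.
  move: c; change ([set u | forall b, b \in s -> dot b u <= 0] x); rewrite IHs.
  apply: gen_sub xg' => -[k|[k l]] /=; case: ifP => [H|_]; try exact: gen0.
    exact: gen_elt.
  case/andP: H => k0 l0.
  apply: genD; first by apply: genZ; [exact: ltW | exact: gen_elt].
  by rewrite -scaleNr; apply: genZ; [rewrite oppr_ge0 ltW | exact: gen_elt].
move=> c; rewrite inE => /orP[/eqP->|/IHs //].
rewrite dotC; apply: polar_gen xg' => -[k|[k l]] /=; case: ifP => [H|_];
  rewrite ?dot0l // dotC //.
by rewrite !dotE -/(bt l) -/(bt k) mulrC subrr.
Qed.

Lemma weyl I (b : I -> 'rV[R]_n) : exists J (g : J -> 'rV[R]_n), polar b = gen g.
Proof.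
have [J [g gP]] := weyl_seq (codom b); exists J, g; rewrite -gP.
apply/seteqP; split => u uP => [_ /codomP[i ->] //|i]; apply: uP.
exact: codom_f.
Qed.

Definition gen_mx I (g : I -> 'rV[R]_n) : 'M[R]_(#|I|, n) :=
  \matrix_(i < #|I|) g (enum_val i).

Lemma dot_mx x y : dot x y = (x *m y^T) 0 0.
Proof. by rewrite mxE; apply: eq_bigr => i _; rewrite mxE. Qed.

Lemma gen_mx_elt I (g : I -> 'rV[R]_n) i : (g i <= gen_mx g)%MS.
Proof. by apply: (eq_row_sub (enum_rank i)); rewrite rowK enum_rankK. Qed.

Lemma gen_mx_sub I (g : I -> 'rV[R]_n) m (M : 'M[R]_(m, n)) :
  (forall i, (g i <= M)%MS) -> (gen_mx g <= M)%MS.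
Proof. by move=> gM; apply/row_subP => i; rewrite rowK. Qed.

Lemma dot_gen_mx0 I (g : I -> 'rV[R]_n) x w :
  (x <= gen_mx g)%MS -> (forall i, dot (g i) w = 0) -> dot x w = 0.
Proof.
move=> /submxP[c ->] gw; rewrite dot_mx -mulmxA mxE big1 // => i _.
rewrite [X in _ * X](_ : _ = 0) ?mulr0 // -(gw (enum_val i)) mxE.
by apply: eq_bigr => j _; rewrite !mxE.
Qed.

(** The columns of [cokermx] are orthogonal to all generators, and vanishing against them
    characterizes the row space. *)
Lemma sub_gen_mx I (g : I -> 'rV[R]_n) x :
  (forall w, (forall i, dot (g i) w = 0) -> dot x w = 0) -> (x <= gen_mx g)%MS.
Proof.
move=> xP; rewrite submxE; apply/eqP/rowP => j; rewrite [RHS]mxE.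
have colE z : (z *m cokermx (gen_mx g)) 0 j = dot z (col j (cokermx (gen_mx g)))^T.
  by rewrite mxE; apply: eq_bigr => i _; rewrite !mxE.
rewrite colE; apply: xP => i; rewrite -colE.
by have := gen_mx_elt g i; rewrite submxE => /eqP ->; rewrite mxE.
Qed.

Lemma gen_sub_mx I (g : I -> 'rV[R]_n) x : gen g x -> (x <= gen_mx g)%MS.
Proof.
move=> [w _ ->]; apply: summx_sub => i _; apply: scalemx_sub; exact: gen_mx_elt.
Qed.

Lemma affdim_rank I (g : I -> 'rV[R]_n) (X : set 'rV[R]_n) x0 :
    X x0 -> (forall x, X x -> (x - x0 <= gen_mx g)%MS) ->
  (forall i, X (x0 + g i)) -> affdim X = \rank (gen_mx g).
Proof.
move=> Xx0 Xsub Xg; apply/eqP; rewrite eqn_leq; apply/andP; split.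
  apply/bigmax_leqP => k /asboolP [x [Y [Xx XY /eqP <-]]].
  apply: mxrankS; apply/row_subP => i.
  have -> : row i Y = (x + row i Y - x0) - (x - x0).
    by rewrite opprB addrA subrK addrC addKr.
  by rewrite addmx_sub ?eqmx_opp ?Xsub.
have rn : (\rank (gen_mx g) < n.+1)%N by rewrite ltnS rank_leq_col.
apply: (leq_bigmax_cond (Ordinal rn)); apply/asboolP.
exists x0, (rowsub (maxrankfun (gen_mx g)) (gen_mx g)); split => //=.
  by move=> i; rewrite row_rowsub rowK.
by rewrite maxrowsub_free.
Qed.

(** Generators not orthogonal to [e] are zeroed rather than removed, which keeps the index type and
    does not affect the cone or span of the others. *)
Definition tight I (g : I -> 'rV[R]_n) e i : 'rV[R]_n :=
  if dot (g i) e == 0 then g i else 0.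

Lemma tight0 I (g : I -> 'rV[R]_n) e w :
  (forall i, dot (tight g e i) w = 0) <->
  (forall i, dot (g i) e = 0 -> dot (g i) w = 0).
Proof.
rewrite /tight; split => H i => [ie|]; first by have := H i; rewrite ie eqxx.
by case: ifPn => [/eqP/H//|_]; rewrite dot0l.
Qed.

(** [e] spans an extreme ray of the polar cone modulo its lineality space; the second clause keeps
    [e] out of that space. *)
Definition extreme I (g : I -> 'rV[R]_n) e : Prop :=
  [/\ polar g e, exists i, dot (g i) e != 0 &
    forall w, (forall i, dot (g i) e = 0 -> dot (g i) w = 0) ->
      exists t, forall i, dot (g i) (w - t *: e) = 0].

(** A single generator off the hyperplane of [e] restores the full span: extremality makes any other
    one a multiple of it modulo the tight span. The sum is direct because [e] vanishes on the tight
    span but not on [g i0]. *)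
Lemma rank_tight I (g : I -> 'rV[R]_n) e :
  extreme g e -> (\rank (gen_mx (tight g e))).+1 = \rank (gen_mx g).
Proof.
move=> [_ [i0 i0P] eP]; set T := gen_mx _; set M := gen_mx _.
have Te x : (x <= T)%MS -> dot x e = 0.
  by move=> /dot_gen_mx0; apply; apply/tight0.
have MT : (M == T + g i0)%MS.
  apply/andP; split.
    apply: gen_mx_sub => i; set c := dot (g i) e / dot (g i0) e.
    rewrite -[g i](subrK (c *: g i0)); apply: addmx_sub_adds; last exact: scalemx_sub.
    apply: sub_gen_mx => w /tight0/eP[t tP].
    have := tP i; have := tP i0; rewrite !dotE => /eqP; rewrite subr_eq0 => /eqP ->.
    by move=> /eqP; rewrite subr_eq0 => /eqP ->; rewrite /c; field.
  rewrite addsmx_sub gen_mx_elt andbT.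
  apply: gen_mx_sub => i; rewrite /tight; case: ifP => _; last exact: sub0mx.
  exact: gen_mx_elt.
rewrite (eqmxP MT) mxrank_disjoint_sum.
  rewrite rank_rV; have [g0|_] := eqVneq (g i0) 0; last by rewrite addn1.
  by rewrite g0 dot0l eqxx in i0P.
apply/eqP/rowV0P => x; rewrite sub_capmx => /andP[/Te xe /sub_rVP[t xE]].
move: xe; rewrite xE dotZl => /eqP; rewrite mulf_eq0 (negbTE i0P) orbF => /eqP ->.
by rewrite scale0r.
Qed.

Lemma argmax_gen I (g : I -> 'rV[R]_n) e :
  polar g e -> argmax (gen g) e = gen (tight g e).
Proof.
move=> ge; apply/seteqP; split => x.
  move=> [[w w0 ->] xmax]; exists w => //; apply: eq_bigr => i _.
  rewrite /tight; case: eqP => // /eqP ie.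
  have := xmax _ (gen0 g); rewrite dot0r dotC dot_suml => le0.
  have le i' : dot (w i' *: g i') e <= 0 by rewrite dotZl mulr_ge0_le0.
  have /eqP : \sum_i - dot (w i *: g i) e = 0.
    apply/eqP; rewrite sumrN oppr_eq0 eq_le le0 andbT; exact: sumr_le0.
  rewrite psumr_eq0; last by move=> j _; rewrite oppr_ge0.
  move=> /allP /(_ i); rewrite mem_index_enum => /(_ isT) /=.
  by rewrite oppr_eq0 dotZl mulf_eq0 (negbTE ie) orbF => /eqP ->; rewrite !scale0r.
move=> xg; split.
  apply: gen_sub xg => i; rewrite /tight; case: ifP => _; [exact: gen_elt | exact: gen0].
move=> y yg; rewrite (dotC e x) (dot_gen_mx0 (gen_sub_mx xg)); last exact/tight0.
by rewrite dotC; exact: polar_gen yg.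
Qed.

Lemma facet_gen I (g : I -> 'rV[R]_n) e :
  extreme g e -> facet (gen g) (argmax (gen g) e).
Proof.
move=> ge; have [eP _ _] := ge; split.
  split; last by exists e.
  by rewrite argmax_gen //; exists 0; exact: gen0.
have dim J (f : J -> 'rV[R]_n) : affdim (gen f) = \rank (gen_mx f).
  apply: (@affdim_rank _ _ _ 0) => [|x|i]; rewrite ?subr0 ?add0r.
  - exact: gen0.
  - exact: gen_sub_mx.
  - exact: gen_elt.
by rewrite argmax_gen // !dim rank_tight.
Qed.

End Generators.

(** * Relative interior of a finitely generated cone *)

Section RelativeInterior.
Context {R : realType} {n : nat}.

(** The sum of all generators has all coefficients 1, and a small move inside the span changes each
    by at most 1. *)
Lemma relint_gen_nonempty (I : finType) (g : I -> 'rV[R]_n) :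
  relint (gen g) !=set0.
Proof.
pose x := \sum_i g i; exists x.
have xg : gen g x by apply: gen_sum => i; exact: gen_elt.
split => //; pose D := pinvmx (gen_mx g).
(* [c] bounds the absolute column sums of the pseudo-inverse [D], hence the coefficients of a
   displacement; the summand 1 makes it positive. *)
pose c := 1 + \sum_i \sum_j `|D i j|.
have sum_ge0 (J : finType) (f : J -> R) : 0 <= \sum_j `|f j| by exact: sumr_ge0.
have c0 : 0 < c.
  by rewrite ltr_pwDl //; apply: sumr_ge0 => i _.
apply/nbhs_ballP; exists c^-1 => /=; first by rewrite invr_gt0.
move=> y xy [m [p [w [pg _ yE]]]].
have sub : (y - x <= gen_mx g)%MS.
  rewrite addmx_sub ?eqmx_opp ?(gen_sub_mx xg) // yE.
  by apply: summx_sub => i _; rewrite scalemx_sub // gen_sub_mx.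
pose l := (y - x) *m D.
have lE : y = \sum_i (1 + l 0 (enum_rank i)) *: g i.
  under eq_bigr do rewrite scalerDl scale1r.
  rewrite big_split /= -/x; apply/eqP; rewrite addrC -subr_eq; apply/eqP.
  rewrite -{1}(mulmxKpV sub) -/D -/l mulmx_sum_row.
  rewrite (reindex (@enum_rank I)) /=; last exact/onW_bij/enum_rank_bij.
  by apply: eq_bigr => i _; rewrite rowK enum_rankK.
exists (fun i => 1 + l 0 (enum_rank i)) => // i.
suff : `|l 0 (enum_rank i)| <= 1 by rewrite ler_norml => /andP[]; lra.
rewrite mxE; apply: (le_trans (ler_norm_sum _ _ _)).
apply: (@le_trans _ _ (\sum_j c^-1 * `|D j (enum_rank i)|)).
  apply: ler_sum => j _; rewrite normrM ler_wpM2r // ltW //.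
  by have [_ /(_ 0 j)] := xy; rewrite -ball_normE /ball_ /= distrC !mxE.
rewrite -mulr_sumr mulrC ler_pdivrMr // mul1r ler_wpDl //.
apply: ler_sum => j _; rewrite (bigD1 (enum_rank i)) //= lerDl.
by apply: sumr_ge0.
Qed.

End RelativeInterior.

(** * Polytopes by homogenization, their edges and facets *)

Section Polytopes.
Context {R : realType} {n : nat}.
Implicit Types (P Q : set 'rV[R]_n) (u v w x y e c : 'rV[R]_n) (I J : finType).

Definition hull I (a : I -> 'rV[R]_n) : set 'rV[R]_n :=
  [set x | exists w : I -> R,
    [/\ forall i, 0 <= w i, \sum_i w i = 1 & x = \sum_i w i *: a i]].

(** Homogenization: the last coordinate 1 forces the weights of a conic combination to sum to 1, so
    facts on cones transfer to hulls. *)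
Definition hom x : 'rV[R]_(n + 1) := row_mx x 1%:M.

Lemma hom_sum I (w : I -> R) (a : I -> 'rV[R]_n) x :
  hom x = \sum_i w i *: hom (a i) <-> \sum_i w i = 1 /\ x = \sum_i w i *: a i.
Proof.
have lE : lsubmx (\sum_i w i *: hom (a i)) = \sum_i w i *: a i.
  by rewrite linear_sum; apply: eq_bigr => i _; rewrite linearZ /= row_mxKl.
have rE : rsubmx (\sum_i w i *: hom (a i)) = (\sum_i w i)%:M.
  rewrite linear_sum raddf_sum /=; apply: eq_bigr => i _.
  by rewrite linearZ /= row_mxKr scale_scalar_mx mulr1.
split=> [xE|[w1 xE]]; last by rewrite -[RHS]hsubmxK lE rE w1 -xE.
split; last by rewrite -lE -xE row_mxKl.
by move: rE; rewrite -xE row_mxKr => /matrixP/(_ 0 0); rewrite !mxE eqxx.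
Qed.

Lemma hull_gen I (a : I -> 'rV[R]_n) x : hull a x <-> gen (hom \o a) (hom x).
Proof.
split=> [[w [w0 w1 xE]]|[w w0 xE]]; exists w => //; first exact/hom_sum.
by have [] := (hom_sum w a x).1 xE.
Qed.

Lemma dot_hom (u : 'rV[R]_(n + 1)) x :
  dot u (hom x) = dot (lsubmx u) x + rsubmx u 0 0.
Proof.
rewrite /dot big_split_ord big_ord1 /=; congr (_ + _).
  by apply: eq_bigr => i _; rewrite row_mxEl mxE.
by rewrite row_mxEr !mxE eqxx mulr1.
Qed.

Lemma polytope_hull P : polytope P -> exists m (a : 'I_m -> 'rV[R]_n), P = hull a.
Proof.
move=> [A [/finite_seqP[s ->] _ ->]].
exists (size s), (fun i => s`_i); apply/seteqP; split => x.
  move=> [k [p [w [ps w0 w1 xE]]]]; apply/hull_gen.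
  apply: (@gen_sub _ _ _ _ _ (hom \o p)); last first.
    by apply/hull_gen; exists w.
  move=> i; have pi : (index (p i) s < size s)%N by rewrite index_mem; exact: ps.
  rewrite /= -[p i](nth_index 0 (ps i)).
  exact: (@gen_elt _ _ _ (hom \o fun i : 'I_(size s) => s`_i) (Ordinal pi)).
move=> [w [w0 w1 xE]]; exists (size s), (fun i => s`_i), w; split => //.
by move=> i; exact: mem_nth.
Qed.

(* The constraints come from generators of the polar of the cone over the
   points [(a i, 1)]. *)
Lemma hull_polyhedron I (a : I -> 'rV[R]_n) :
  exists J (h : J -> 'rV[R]_n) (b : J -> R), hull a = polyhedron h b.
Proof.
have [J [g gP]] := weyl (hom \o a).
exists J, (fun j => lsubmx (g j)), (fun j => - rsubmx (g j) 0 0).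
have hE x : (forall j, dot (g j) (hom x) <= 0) <->
    polyhedron (fun j => lsubmx (g j)) (fun j => - rsubmx (g j) 0 0) x.
  by split => H j; have := H j; rewrite dot_hom /=; lra.
apply/seteqP; split => x.
  move=> /hull_gen xa; apply/hE => j; rewrite dotC; apply: polar_gen xa.
  by rewrite gP; exact: gen_elt.
move=> /hE xg; apply/hull_gen; apply: farkas => u.
by rewrite gP dotC => /(polar_gen _); apply => j; exact: xg.
Qed.

Lemma hull_elt I (a : I -> 'rV[R]_n) i : hull a (a i).
Proof. by apply/hull_gen; exact: (gen_elt (hom \o a)). Qed.

Lemma hull_le I (a : I -> 'rV[R]_n) c M x :
  (forall i, dot c (a i) <= M) -> hull a x -> dot c x <= M.
Proof.
move=> cM [w [w0 w1 ->]]; rewrite dot_sumr -[M]mul1r -w1 mulr_suml.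
by apply: ler_sum => i _; rewrite dotZr ler_wpM2l.
Qed.

Lemma hull_bounded I (a : I -> 'rV[R]_n) c :
  exists M, forall x, hull a x -> dot c x <= M.
Proof.
exists (\sum_i `|dot c (a i)|) => x; apply: hull_le => i.
rewrite (le_trans (ler_norm _)) // (bigD1 i) //= lerDl.
exact: sumr_ge0.
Qed.

Lemma hull_cone I (a : I -> 'rV[R]_n) x y :
  hull a x -> gen (fun i => a i - y) (x - y).
Proof.
move=> [w [w0 w1 ->]]; exists w => //; under [RHS]eq_bigr do rewrite scalerBr.
by rewrite sumrB -scaler_suml w1 scale1r.
Qed.

Lemma hull_midpoint I (a : I -> 'rV[R]_n) x y :
  hull a x -> hull a y -> hull a (2%:R^-1 *: (x + y)).
Proof.
move=> [w [w0 w1 ->]] [w' [w'0 w'1 ->]].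
exists (fun i => 2%:R^-1 * (w i + w' i)); split => [i||].
- by rewrite mulr_ge0 ?invr_ge0 ?ler0n // addr_ge0.
- by rewrite -mulr_sumr big_split /= w1 w'1; field.
- rewrite -big_split scaler_sumr; apply: eq_bigr => i _ /=.
  by rewrite -scalerDl scalerA.
Qed.

Lemma hull_feasible I (a : I -> 'rV[R]_n) y u :
  hull a y -> gen (fun i => a i - y) u ->
  exists2 t, 0 < t & forall s, 0 <= s <= t -> hull a (y + s *: u).
Proof.
move=> [p [p0 p1 yE]] [w w0 ->]; pose W := \sum_i w i.
have W0 : 0 <= W by exact: sumr_ge0.
(* A step [s] takes weight [s * W] away from [y]; this bound keeps [1 - s * W] nonnegative and makes
   sense also for [W = 0]. *)
exists (1 + W)^-1 => [|s /andP[s0 st]]; first by rewrite invr_gt0; lra.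
exists (fun i => (1 - s * W) * p i + s * w i); split => [i||].
- rewrite addr_ge0 ?mulr_ge0 // subr_ge0.
  apply: (le_trans (ler_wpM2r W0 st)); rewrite mulrC ler_pdivrMr; lra.
- by rewrite big_split /= -!mulr_sumr p1 -/W; ring.
- under [X in _ + _ *: X]eq_bigr do rewrite scalerBr.
  rewrite sumrB -scaler_suml -/W scalerBr scalerA.
  under [RHS]eq_bigr do rewrite scalerDl -!scalerA.
  rewrite big_split /= -!scaler_sumr -yE scalerBl scale1r.
  by rewrite -addrA; congr (_ + _); rewrite addrC.
Qed.

Lemma edge_argmax Q c y e :
    e != 0 -> argmax Q c y -> argmax Q c (y + e) ->
    (forall w, argmax Q c w -> exists s, w - y = s *: e) ->
  edge Q (argmax Q c).
Proof.
move=> e0 yE yeE line; split; first by split; [exists y | exists c].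
rewrite (@affdim_rank _ _ unit (fun=> e) _ y) //.
  apply/eqP; rewrite eqn_leq (leq_trans (rank_leq_row _)) ?card_unit //=.
  by have := mxrankS (gen_mx_elt (fun=> e) tt); rewrite rank_rV e0.
move=> x /line[s ->]; apply: scalemx_sub; exact: (gen_mx_elt (fun=> e) tt).
Qed.

(** The face is a polyhedron with the extra row [- v]. At a basic point [y] of it [bnd] excludes
    lineality, and a second point of the face yields an extreme ray of the feasible directions at
    [y], which spans the edge. *)
Lemma edge_in_face I (h : I -> 'rV[R]_n) (b : I -> R) v p q :
    (forall u, u != 0 -> exists i, 0 < dot (h i) u) -> p <> q ->
    argmax (polyhedron h b) v p -> argmax (polyhedron h b) v q ->
  exists E x y, [/\ edge (polyhedron h b) E, E `<=` argmax (polyhedron h b) v,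
    E x, E y & x <> y].
Proof.
set Q := polyhedron h b => bnd pq pQ qQ.
pose h' i := if i is Some j then h j else - v.
pose b' i := if i is Some j then b j else - dot v p.
have XP x : polyhedron h' b' x <-> argmax Q v x.
  split => [xX|[xQ xmax] [i|]]; last by rewrite /= dotNl lerN2 xmax //; case: pQ.
    split=> [i|y yQ]; first exact: (xX (Some i)).
    have := xX None; rewrite /= dotNl lerN2; apply: le_trans; exact: pQ.2.
  exact: xQ.
have [||y [/XP yX _ yb]] := @basic_point _ _ _ h' b' 0 p.
- by move=> u; rewrite dot0l ltxx.
- exact/XP.
have {}yb u : (forall i, dot (h' i) y = b' i -> dot (h' i) u = 0) -> u = 0.
  move=> /yb u0; apply/eqP/negPn/negP => /bnd[i]; by rewrite (u0 (Some i)) ltxx.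
have [q' q'X q'y] : exists2 q', argmax Q v q' & q' - y != 0.
  have [yp|yp] := eqVneq p y; last by exists p; rewrite ?subr_eq0.
  by exists q => //; rewrite subr_eq0 -yp; apply/eqP => /esym.
pose g i := if dot (h' i) y == b' i then h' i else 0.
have gP i : dot (h' i) y = b' i -> g i = h' i by rewrite /g => ->; rewrite eqxx.
have vy : dot v y = dot v p.
  by apply/eqP; rewrite eq_le pQ.2 ?yX.2 //; [case: pQ | case: yX].
have gN : g None = - v by apply: gP; rewrite /= dotNl vy.
have g_le x i : polyhedron h' b' x -> dot (g i) x <= dot (g i) y.
  by move=> /(_ i); rewrite /g; case: eqP => [->//|]; rewrite !dot0l.
have gy x i : Q x -> dot (g (Some i)) x <= dot (g (Some i)) y.
  by move=> /(_ i); rewrite /g /=; case: eqP => [->//|]; rewrite !dot0l.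
have [||e [eP ue eb]] := @extreme_ray _ _ _ g (q' - y) (q' - y).
- by move=> i; rewrite dotDr dotNr subr_le0; apply: g_le; exact/XP.
- by rewrite dotxx_gt0.
have {}eb w : (forall i, dot (g i) e = 0 -> dot (g i) w = 0) ->
    w = dot (q' - y) w *: e.
  move=> /eb H; apply/eqP; rewrite -subr_eq0; apply/eqP/yb => i /gP <-; exact: H.
have e0 : e != 0 by apply/eqP => e0; move: ue; rewrite e0 dot0r; lra.
have [t [k [t0 tP kP tk]]] :=
  @ratio_test _ _ (fun i => b i - dot (h i) y) (fun i => dot (h i) e)
    (fun i => etrans (subr_ge0 _ _) (yX.1 i)) (bnd _ e0).
(* For [t = 0] the blocking row [k] would be tight at [y] and increase along [e]. *)
have {k kP tk} tpos : 0 < t.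
  rewrite lt0r t0 andbT; apply/eqP => t00; have := eP (Some k).
  rewrite gP /=; first by rewrite leNgt kP.
  by move: tk; rewrite t00; lra.
have yeQ : Q (y + t *: e) by move=> i; rewrite dotDr dotZr; have := tP i; lra.
have ve : dot v e = 0.
  apply/eqP; rewrite eq_le; have := eP None; rewrite gN dotNl oppr_le0 => ->.
  have := yX.2 _ yeQ; rewrite dotDr dotZr gerDl pmulr_rle0 // => ->; by [].
pose T i := dot (g (Some i)) e == 0.
(* Rows tight at [y] and orthogonal to [e] are added to [v]. Since [y] maximizes every summand, a
   maximizer of the sum maximizes each, so it lies in the face and on the line along [e]. *)
pose c := v + \sum_(i | T i) g (Some i).
have yE : argmax Q c y.
  split=> [|x xQ]; first by case: yX.
  rewrite !dotDl lerD ?yX.2 // !dot_suml; apply: ler_sum => i _; exact: gy.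
have yeE : argmax Q c (y + t *: e).
  split=> // x xQ; apply: (le_trans (yE.2 _ xQ)).
  rewrite dotDr lerDl dotZr dotDl ve dot_suml big1 ?addr0 ?mulr0 //.
  by move=> i /eqP.
have Etight x : argmax Q c x ->
    dot v x = dot v y /\ forall i, T i -> dot (g (Some i)) x = dot (g (Some i)) y.
  move=> [xQ xmax]; have := xmax _ yE.1; rewrite !dotDl !dot_suml => le.
  have le1 := yX.2 _ xQ.
  have le2 (i : I) : T i -> dot (g (Some i)) x <= dot (g (Some i)) y by move=> _; exact: gy.
  pose A z := \sum_(i | T i) dot (g (Some i)) z.
  have le3 : A x <= A y by exact: ler_sum.
  rewrite -/(A x) -/(A y) in le.
  split; first by apply/eqP; rewrite eq_le le1 /=; lra.
  move=> i Ti; apply/eqP; rewrite eq_sym -subr_eq0; apply/eqP.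
  apply: (@psumr_eq0P _ _ T (fun i => dot (g (Some i)) y - dot (g (Some i)) x)) => //.
    by move=> j Tj; rewrite subr_ge0 le2.
  by apply/eqP; rewrite sumrB -/(A x) -/(A y) eq_le subr_ge0 le3 andbT; lra.
exists (argmax Q c), y, (y + t *: e); split => //.
- apply: (edge_argmax _ yE yeE); first by rewrite scaler_eq0 negb_or gt_eqF.
  move=> x /Etight[vx gx]; exists (dot (q' - y) (x - y) / t).
  rewrite scalerA divfK ?gt_eqF //; apply: eb => -[i|] ie.
    by rewrite dotDr dotNr gx ?subrr //; apply/eqP.
  by rewrite gN !dotE vx; ring.
- by move=> x xE; have [vx _] := Etight _ xE; split; [case: xE|rewrite vx; case: yX].
- move=> /eqP; rewrite -subr_eq0 opprD addrA subrr add0r oppr_eq0.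
  by rewrite scaler_eq0 gt_eqF //= (negbTE e0).
Qed.

(** Seen from [y], the polytope spans all generators [a i - y] and the face only the tight ones;
    their ranks differ by one. *)
Lemma facet_hull I (a : I -> 'rV[R]_n) y e :
    hull a y -> extreme (fun i => a i - y) e ->
  facet (hull a) (argmax (hull a) e) /\ argmax (hull a) e y.
Proof.
move=> ya ext; have [eP _ _] := ext; set g := fun i => a i - y in ext eP *.
have le x : hull a x -> dot e x <= dot e y.
  by apply: hull_le => i; have := eP i; rewrite dotC !dotE subr_le0.
have yE : argmax (hull a) e y by [].
split => //; split; first by split; [exists y | exists e].
rewrite (@affdim_rank _ _ _ (tight g e) _ y) //.
- rewrite (rank_tight ext) (@affdim_rank _ _ _ g _ y) //.
    by move=> x /(hull_cone y); exact: gen_sub_mx.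
  by move=> i; rewrite /g addrC subrK; exact: hull_elt.
- move=> x [xa xmax]; apply: gen_sub_mx; rewrite -argmax_gen //; split.
    exact: hull_cone.
  move=> z zg; apply: (@le_trans _ _ 0); first by rewrite dotC; exact: polar_gen zg.
  by rewrite !dotE subr_ge0 xmax.
- move=> i; rewrite /tight; case: eqP => [|_]; last by rewrite addr0.
  rewrite /g dotC !dotE => /eqP; rewrite subr_eq0 => /eqP ie.
  rewrite addrC subrK; split; first exact: hull_elt.
  by move=> x /le; rewrite ie.
Qed.

End Polytopes.

(** * Central sections, and normal cones as polars *)

Section CentralSections.
Context {R : realType} {n : nat}.
Implicit Types (P F G : set 'rV[R]_n) (u v w x y z c e : 'rV[R]_n) (I J : finType).

Lemma reflectionP P z w : (P `&` reflection z P) w <-> P w /\ P (2%:R *: z - w).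
Proof.
split=> -[Pw]; first by case=> y Py yw; split=> //; rewrite -yw subKr.
by split=> //; exists (2%:R *: z - w) => //; rewrite subKr.
Qed.

Lemma scaler2B x : 2%:R *: x - x = x.
Proof. by rewrite scaler_nat mulr2n addrK. Qed.

Lemma section_polyhedron I (a : I -> 'rV[R]_n) z : hull a z ->
  exists J (h : J -> 'rV[R]_n) b, hull a `&` reflection z (hull a) = polyhedron h b
    /\ forall u, u != 0 -> exists i, 0 < dot (h i) u.
Proof.
move=> za; have [J [h [b hE]]] := hull_polyhedron a.
pose h' (i : J + J) := match i with inl j => h j | inr j => - h j end.
pose b' (i : J + J) :=
  match i with inl j => b j | inr j => b j - dot (h j) (2%:R *: z) end.
have QE : hull a `&` reflection z (hull a) = polyhedron h' b'.
  apply/seteqP; split => w.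
    move=> /reflectionP[]; rewrite hE => w1 w2 [j|j]; first exact: w1.
    by have := w2 j; rewrite /= !dotE; lra.
  move=> wh; apply/reflectionP; rewrite hE; split => j; first exact: (wh (inl j)).
  by have := wh (inr j); rewrite /= !dotE; lra.
exists (J + J)%type, h', b'; split => // u u0.
apply: contrapT => /forallNP noi; have [M MP] := hull_bounded a u.
have uu : 0 < dot u u by rewrite dotxx_gt0.
(* Large enough for [dot u] to exceed its bound [M] at [z + t *: u]. *)
pose t := (`|M - dot u z| + 1) / dot u u.
have t0 : 0 <= t by rewrite divr_ge0 ?addr_ge0 // ltW.
have zQ : (hull a `&` reflection z (hull a)) z.
  by apply/reflectionP; rewrite scaler2B.
have [|ta _] := (reflectionP (hull a) z (z + t *: u)).1.
  move: zQ; rewrite QE => zQ i; have := zQ i; rewrite !dotE => zi.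
  have ui : dot (h' i) u <= 0 by rewrite leNgt; apply/negP/noi.
  by have := mulr_ge0_le0 t0 ui; lra.
have := MP _ ta; rewrite !dotE divfK ?gt_eqF //.
by have := ler_norm (M - dot u z); lra.
Qed.

Lemma section_argmax I (a : I -> 'rV[R]_n) z c : hull a z ->
  argmax (hull a `&` reflection z (hull a)) c !=set0.
Proof.
move=> za; have [J [h [b [QE bnd]]]] := section_polyhedron za; rewrite QE.
apply: argmax_nonempty => [u cu|].
  by apply: bnd; apply: contraTneq cu => ->; rewrite dot0r ltxx.
by exists z; rewrite -QE; apply/reflectionP; rewrite scaler2B.
Qed.

Lemma section_edge I (a : I -> 'rV[R]_n) z c p q :
    let Q := hull a `&` reflection z (hull a) in
    hull a z -> argmax Q c p -> argmax Q c q -> p <> q ->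
  exists E x y, [/\ edge Q E, E `<=` argmax Q c, E x, E y & x <> y].
Proof.
move=> Q za; have [J [h [b [QE bnd]]]] := section_polyhedron za.
by rewrite /Q QE => pQ qQ pq; exact: (edge_in_face bnd pq pQ qQ).
Qed.

(** Two maximizers would put an edge of the section into the face, with direction perpendicular to
    [v]. *)
Lemma section_argmax_unique I (a : I -> 'rV[R]_n) v z c p q :
    positively_oriented (hull a) v -> hull a z -> c = v \/ c = - v ->
    argmax (hull a `&` reflection z (hull a)) c p ->
    argmax (hull a `&` reflection z (hull a)) c q -> p = q.
Proof.
move=> orP za cv pQ qQ; apply: contrapT => pq.
have [E [x [y [edgeE Ec Ex Ey xy]]]] := section_edge za pQ qQ pq.
apply: (orP _ za (x - y)); first by exists E, x, y.
have cxy : dot c x = dot c y.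
  have [xQ xmax] := Ec _ Ex; have [yQ ymax] := Ec _ Ey.
  by apply/eqP; rewrite eq_le xmax ?ymax.
by case: cv cxy => ->; rewrite !dotE (dotC x) (dotC y) => /eqP; lra.
Qed.

Lemma argmax_reflect P z c y :
  argmax (P `&` reflection z P) c y ->
  argmax (P `&` reflection z P) (- c) (2%:R *: z - y).
Proof.
move=> [/reflectionP[y1 y2] ymax]; split.
  by apply/reflectionP; rewrite subKr.
move=> w /reflectionP[w1 w2]; have := ymax (2%:R *: z - w).
rewrite !dotE => H; suff : 2%:R * dot c z - dot c w <= dot c y by lra.
by apply: H; apply/reflectionP; rewrite subKr.
Qed.

(** [y] is the barycentre of the generators lying in [F], standing in for a relative interior point.
    If [b] is maximal at [y], its defects at these generators are nonnegative with sum 0, so [b] is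
    maximal on all of [F]. *)
Lemma face_point I (a : I -> 'rV[R]_n) F : face (hull a) F ->
  exists2 y, F y & normal_cone (hull a) F = polar (fun i => a i - y).
Proof.
move=> [[f Ff] [c FE]]; rewrite FE in Ff *.
pose T i := dot c (a i) == dot c f.
have aT i : T i -> argmax (hull a) c (a i).
  move=> /eqP iT; split=> [|w wa]; first exact: hull_elt.
  by rewrite iT; exact: Ff.2.
have off (w : I -> R) x : argmax (hull a) c x -> (forall i, 0 <= w i) -> \sum_i w i = 1 ->
    x = \sum_i w i *: a i -> forall i, ~~ T i -> w i = 0.
  move=> xF w0 w1 xE i iT.
  have ge0 j : 0 <= w j * (dot c f - dot c (a j)).
    by rewrite mulr_ge0 // subr_ge0; apply: Ff.2; exact: hull_elt.
  have /eqP : \sum_j w j * (dot c f - dot c (a j)) = 0.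
    under eq_bigr do rewrite mulrBr -[w _ * dot c (a _)]dotZr.
    rewrite sumrB -mulr_suml w1 -dot_sumr -xE mul1r; apply/eqP.
    by rewrite subr_eq0 eq_le xF.2 ?Ff.2 //; [case: xF | case: Ff].
  rewrite psumr_eq0 // => /allP/(_ i); rewrite mem_index_enum => /(_ isT)/=.
  by rewrite mulf_eq0 subr_eq0 [dot c f == _]eq_sym -/(T i) (negbTE iT) orbF => /eqP.
have [w [w0 w1 fE]] := Ff.1.
have T0 : (0 < #|T|)%N.
  rewrite lt0n; apply/eqP => /card0_eq noT; have : \sum_i w i = 0.
    by rewrite big1 // => i _; apply: (off _ _ Ff w0 w1 fE); rewrite -[T i]/(i \in T) noT.
  by rewrite w1 => /eqP; rewrite oner_eq0.
pose N : R := #|T|%:R; have N0 : 0 < N by rewrite ltr0n.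
pose y := N^-1 *: \sum_(i | T i) a i.
have dy b : dot b y = N^-1 * \sum_(i | T i) dot b (a i) by rewrite dotZr dot_sumr.
have sumT t : \sum_(i | T i) t = N * t by rewrite sumr_const -mulr_natl.
have ya : hull a y.
  exists (fun i => if T i then N^-1 else 0); split => [i||].
  - by case: ifP => // _; rewrite invr_ge0 ltW.
  - by rewrite -big_mkcond sumT divff // gt_eqF.
  - rewrite /y scaler_sumr big_mkcond /=; apply: eq_bigr => i _.
    by case: ifP => // _; rewrite scale0r.
have yF : argmax (hull a) c y.
  split=> // z za; rewrite dy (eq_bigr (fun=> dot c f)) => [|i /eqP //].
  by rewrite sumT mulKf ?gt_eqF //; exact: Ff.2.
clearbody y; exists y => //; apply/seteqP; split => b.
  move=> bN i; rewrite dotC !dotE subr_le0.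
  exact: ((bN _ yF).2 _ (hull_elt a i)).
move=> bP x xF; split; first by case: xF.
have bT i : T i -> dot b (a i) = dot b y.
  move=> Ti; apply/eqP; rewrite eq_sym -subr_eq0; apply/eqP.
  apply: (@psumr_eq0P _ _ T (fun i => dot b y - dot b (a i))) => //.
    by move=> j _; have := bP j; rewrite dotC !dotE subr_le0 subr_ge0.
  by rewrite sumrB sumT dy mulVKf ?gt_eqF // subrr.
have -> : dot b x = dot b y.
  have [[w' [w'0 w'1 xE]] _] := xF.
  rewrite {1}xE dot_sumr -[RHS]mul1r -w'1 mulr_suml; apply: eq_bigr => i _.
  rewrite dotZr; have [/bT ->//|iT] := boolP (T i).
  by rewrite (off _ _ xF w'0 w'1 xE _ iT) !mul0r.
by move=> z; apply: hull_le => i; have := bP i; rewrite dotC !dotE subr_le0.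
Qed.

Lemma Cone_gen I (B : I -> 'rV[R]_n) (X : set 'rV[R]_n) :
  X `<=` gen B -> (forall i, X (B i)) -> Cone X = gen B.
Proof.
move=> XB BX; apply/seteqP; split => x.
  move=> [k [p [w [pX w0 xE]]]]; apply: (@gen_sub _ _ _ _ _ p); last by exists w.
  by move=> i; exact/XB.
move=> [w w0 ->]; exists #|I|, (fun i => B (enum_val i)), (fun i => w (enum_val i)).
split => //; rewrite (reindex (@enum_rank I)) /=; last exact/onW_bij/enum_rank_bij.
by apply: eq_bigr => i _; rewrite enum_rankK.
Qed.

Lemma pair_cone_gen I (a : I -> 'rV[R]_n) F G :
    face (hull a) F -> face (hull a) G ->
  exists J (B : J -> 'rV[R]_n), pair_cone (hull a) F G = gen B.
Proof.
move=> /face_point[x _ NF] /face_point[y _ NG].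
have [J1 [f fE]] := weyl (fun i => a i - x).
have [J2 [g gE]] := weyl (fun i => a i - y).
pose B (i : J1 + J2) := match i with inl j => - f j | inr j => g j end.
exists (J1 + J2)%type, B; apply: Cone_gen.
  move=> c [[c' ]|]; rewrite ?NF ?NG ?fE ?gE.
    move=> [w w0 ->] <-; apply: (@gen_sub _ _ _ _ _ (fun j => - f j)).
      by move=> j; exact: (gen_elt B (inl j)).
    by exists w => //; rewrite -sumrN; apply: eq_bigr => i _; rewrite scalerN.
  by apply: gen_sub => j; exact: (gen_elt B (inr j)).
move=> [j|j]; [left; exists (f j) => // | right]; rewrite ?NF ?NG ?fE ?gE; exact: gen_elt.
Qed.

Lemma face_sub P F : face P F -> F `<=` P.
Proof. by move=> [_ [c ->]] x []. Qed.

Lemma normal_cone_comb P F s t c c' : F `<=` P -> 0 <= s -> 0 <= t ->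
  normal_cone P F c -> normal_cone P F c' -> normal_cone P F (s *: c + t *: c').
Proof.
move=> FP s0 t0 cF c'F x Fx; split=> [|y Py]; first exact: FP.
rewrite !dotE; apply: lerD; apply: ler_wpM2l => //.
  by case: (cF _ Fx) => _; apply.
by case: (c'F _ Fx) => _; apply.
Qed.

Lemma pair_coneP P F G c : face P F -> face P G -> pair_cone P F G c ->
  exists f g, [/\ normal_cone P F f, normal_cone P G g & c = g - f].
Proof.
move=> /face_sub FP /face_sub GP [k [p [w [pX w0 ->]]]].
have N0 E : E `<=` P -> normal_cone P E 0.
  by move=> EP x Ex; split=> [|y _]; [exact: EP | rewrite !dot0l].
apply: (big_ind (fun c => exists f g,
    [/\ normal_cone P F f, normal_cone P G g & c = g - f])).
- by exists 0, 0; split; rewrite ?subr0 //; exact: N0.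
- move=> _ _ [f [g [fN gN ->]]] [f' [g' [f'N g'N ->]]]; exists (f + f'), (g + g').
  rewrite opprD addrACA; split => //.
    by have := normal_cone_comb FP ler01 ler01 fN f'N; rewrite !scale1r.
  by have := normal_cone_comb GP ler01 ler01 gN g'N; rewrite !scale1r.
- move=> i _; case: (pX i) => [[f fN <-]|gN].
    exists (w i *: f), 0; rewrite sub0r scalerN; split => //; last exact: N0.
    by have := normal_cone_comb FP (w0 i) ler01 fN (N0 _ FP); rewrite scaler0 addr0.
  exists 0, (w i *: p i); rewrite subr0; split => //; first exact: N0.
  by have := normal_cone_comb GP (w0 i) ler01 gN (N0 _ GP); rewrite scaler0 addr0.
Qed.

Lemma pair_cone_l P F G c : normal_cone P F c -> pair_cone P F G (- c).
Proof.
move=> cN; exists 1%N, (fun=> - c), (fun=> 1); split => [_||] //; last first.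
  by rewrite big_ord1 scale1r.
by left; exists c.
Qed.

Lemma pair_cone_r P F G c : normal_cone P G c -> pair_cone P F G c.
Proof.
move=> cN; exists 1%N, (fun=> c), (fun=> 1); split => [_||] //; last first.
  by rewrite big_ord1 scale1r.
by right.
Qed.

End CentralSections.

(** * Facet normals, the pair cone and the image of the diagonal *)

Section Diagonal.
Context {R : realType} {n : nat}.
Implicit Types (P F G H : set 'rV[R]_n) (u v w x y z c d e : 'rV[R]_n) (I J : finType).

Lemma outward_normal_cone P F E d :
  outward_normal P E d -> F `<=` E -> normal_cone P F d.
Proof.
move=> [m EP dP] FE x /FE; rewrite -EP => -[Px /= dx].
by split=> // y /dP; rewrite dx.
Qed.

(** The component of [d] orthogonal to [e] lies in the common hyperplane, so it is orthogonal to [d]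
    too, hence to itself. *)
Lemma normal_vector_hyperplane e d : e != 0 -> normal_vector (hyperplane e) d ->
  exists2 s, s != 0 & d = s *: e.
Proof.
move=> e0 [/eqP d0 eqH]; pose s := dot d e / dot e e.
have ee : dot e e != 0 by rewrite dotxx_eq0.
have ew : dot e (d - s *: e) = 0.
  by rewrite !dotE divfK // (dotC e) subrr.
have dw : dot d (d - s *: e) = 0.
  by move: ew; rewrite -[_ = 0]/(hyperplane e _) eqH.
have dE : d = s *: e.
  apply/eqP; rewrite -subr_eq0 -dotxx_eq0 dotDl dw add0r dotNl dotZl ew.
  by rewrite mulr0 oppr0.
by exists s => //; apply: contra d0 => /eqP s0; rewrite dE s0 scale0r.
Qed.

(** An extreme ray [e] of the normal cone with [dot u e = 1] exposes the facet, and on differences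
    of points of the polytope any outward normal [d] of it acts as [dot u d] times [e]. The premise
    that [u] is parallel to the affine hull prevents [e] from being constant. *)
Lemma facet_normal I (a : I -> 'rV[R]_n) F c u :
    face (hull a) F -> normal_cone (hull a) F c ->
    (forall l, (forall p q, hull a p -> hull a q -> dot l p = dot l q) ->
      dot l u = 0) ->
    0 < dot c u ->
  exists E, [/\ facet (hull a) E, F `<=` E &
    forall d, outward_normal (hull a) E d -> 0 < dot d u].
Proof.
move=> faceF cN ulin cu; have [x Fx NF] := face_point faceF.
have xa := face_sub faceF Fx.
set g := fun i => a i - x in NF.
have cg : polar g c by rewrite -NF.
have [|e [eP ue eb]] := @extreme_ray _ _ _ g u c cg; first by rewrite dotC.
have [i0 i0e] : exists i, dot (g i) e < 0.
  apply: contrapT => /forallNP noi; move/eqP: ue; rewrite dotC ulin ?(eq_sym 0) ?oner_eq0 //.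
  suff eq p : hull a p -> dot e p = dot e x by move=> p q /eq -> /eq ->.
  move=> /(hull_cone x) [w w0 pE]; apply/eqP; rewrite -subr_eq0 -dotNr -dotDr.
  rewrite pE dot_sumr big1 // => i _; rewrite dotZr -/(g i) dotC.
  suff -> : dot (g i) e = 0 by rewrite mulr0.
  by apply/eqP; rewrite eq_le eP leNgt; apply/negP/noi.
have ext : extreme g e.
  split=> //; first by exists i0; rewrite lt_eqF.
  by move=> w /eb wP; exists (dot u w).
have [facetE xE] := facet_hull xa ext.
exists (argmax (hull a) e); split => //.
  by rewrite -[F `<=` _]/(normal_cone (hull a) F e) NF.
move=> d [m EP dm]; set E := argmax (hull a) e in EP xE *.
have dE w : E w -> dot d w = m by rewrite -EP => -[].
have dg w : (forall i, dot (g i) e = 0 -> dot (g i) w = 0) ->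
    forall i, dot (g i) w = dot u w * dot (g i) e.
  by move=> /eb wP i; have := wP i; rewrite dotDr dotNr dotZr => /eqP; rewrite subr_eq0 => /eqP.
have tightd i : dot (g i) e = 0 -> dot (g i) d = 0.
  rewrite /g !dotDl !dotNl => /eqP; rewrite subr_eq0 => /eqP ie.
  rewrite (dotC _ d) (dotC x) (dE x xE) dE ?subrr //; split; first exact: hull_elt.
  by move=> y ya; rewrite (dotC e (a i)) ie (dotC x) xE.2.
have := dg _ tightd i0 => gd.
(* Both [e] and [d] drop from the facet to the generator [a i0] off it, which fixes the sign of
   [dot u d]. *)
have gd0 : dot (g i0) d < 0.
  rewrite /g dotDl dotNl (dotC _ d) (dotC x) (dE _ xE) subr_lt0 lt_neqAle.
  rewrite dm ?andbT; last exact: hull_elt.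
  apply/eqP => ai; have : E (a i0) by rewrite -EP; split => //; exact: hull_elt.
  move=> [_ /(_ _ xa)]; move: i0e; rewrite /g dotC !dotE; lra.
by move: gd0; rewrite gd nmulr_llt0 // dotC.
Qed.

Section Pair.
Context {I : finType} {a : I -> 'rV[R]_n} {F G : set 'rV[R]_n}.
Hypotheses (faceF : face (hull a) F) (faceG : face (hull a) G).
Let P := hull a.

(** Both [w] and [x + y - w] lie in [P]: the first gives that [g] at [w] is at most its value at
    [y], the second that [f] at [w] is at least its value at [y]. *)
Lemma pair_cone_argmax x y z c : F x -> G y -> x + y = 2%:R *: z ->
  pair_cone P F G c -> argmax (P `&` reflection z P) c y.
Proof.
move=> Fx Gy xyz /(pair_coneP faceF faceG)[f [g [fN gN ->]]]; split.
  apply/reflectionP; rewrite -xyz addrK.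
  by split; [exact: (face_sub faceG) | exact: (face_sub faceF)].
move=> w /reflectionP[w1 w2]; have := (gN _ Gy).2 _ w1; have := (fN _ Fx).2 _ w2.
by rewrite -xyz !dotE; lra.
Qed.

(** By Farkas, [u] is a feasible direction of [P] at [y] and [- u] one at [x]; reflection turns the
    latter into the second constraint of the section. *)
Lemma pair_cone_feasible x y u :
    normal_cone P F = polar (fun i => a i - x) ->
    normal_cone P G = polar (fun i => a i - y) -> P x -> P y ->
    (forall c, pair_cone P F G c -> dot c u <= 0) ->
  exists2 t, 0 < t &
    forall z, x + y = 2%:R *: z -> (P `&` reflection z P) (y + t *: u).
Proof.
move=> NF NG Px Py uP.
have [|t1 t1P t1y] := @hull_feasible _ _ _ a y u Py.
  apply: farkas => c; rewrite -NG dotC => cN; apply: uP; exact: pair_cone_r.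
have [|t2 t2P t2x] := @hull_feasible _ _ _ a x (- u) Px.
  apply: farkas => c; rewrite -NF dotNl -dotNr dotC => cN; apply: uP; exact: pair_cone_l.
exists (Num.min t1 t2) => [|z xyz]; first by rewrite lt_min t1P.
have t0 : 0 <= Num.min t1 t2 by rewrite le_min !ltW.
apply/reflectionP; rewrite -xyz; split.
  by apply: t1y; rewrite t0 ge_min lexx.
rewrite opprD addrA addrK -scalerN; apply: t2x.
by rewrite t0 ge_min lexx orbT.
Qed.

Lemma in_im_diagonalP v : positively_oriented P v ->
  in_im_diagonal P v F G <-> pair_cone P F G v.
Proof.
move=> orP; split; last first.
  move=> vC [x y] [/= Fx Gy].
  have Px := face_sub faceF Fx; have Py := face_sub faceG Gy.
  pose z := 2%:R^-1 *: (x + y).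
  have xyz : x + y = 2%:R *: z by rewrite scalerA divff ?scale1r // pnatr_eq0.
  have za : P z by exact: hull_midpoint.
  have yQ := pair_cone_argmax Fx Gy xyz vC.
  have xQ := argmax_reflect yQ; rewrite -xyz addrK in xQ.
  exists z => //; congr (_, _).
    apply: (section_argmax_unique orP za _ _ xQ); [by right|].
    by apply: xgetPex; exists x.
  apply: (section_argmax_unique orP za _ _ yQ); [by left|].
  by apply: xgetPex; exists y.
move=> im; have [x Fx NF] := face_point faceF; have [y Gy NG] := face_point faceG.
have [z za [xE yE]] : (Defs.diagonal P v @` P) (x, y) by exact: im.
have yQ : argmax (P `&` reflection z P) v y.
  by rewrite -yE; apply: xgetPex; exact: section_argmax.
have xQ : argmax (P `&` reflection z P) (- v) x.
  by rewrite -xE; apply: xgetPex; exact: section_argmax.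
(* Reflection in [z] exchanges minimizers and maximizers, so uniqueness forces [z] to be the
   midpoint. *)
have xyz : x + y = 2%:R *: z.
  rewrite (section_argmax_unique orP za _ xQ (argmax_reflect yQ)) ?subrK //.
  by right.
have [J [B CB]] := pair_cone_gen faceF faceG; rewrite /P CB.
apply: contrapT => /farkasN[u uB vu].
have [|t t0 /(_ z xyz) yu] := pair_cone_feasible (u := u) NF NG
    (face_sub faceF Fx) (face_sub faceG Gy).
  by move=> c; rewrite /P CB => /(polar_gen uB).
by have := yQ.2 _ yu; rewrite !dotE gerDl pmulr_rle0 // leNgt vu.
Qed.

(** For [d H] the conclusion denies the sign condition, as the pair cone contains the outward
    normals of facets through [G] and the opposites of those through [F]. *)
Lemma violated_hyperplane v : ~ pair_cone P F G v ->
  exists2 H, arrangement_at P F G H & forall d, normal_vector H d ->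
    0 < dot d v -> forall c, pair_cone P F G c -> dot c d <= 0.
Proof.
have [J [B CB]] := pair_cone_gen faceF faceG; rewrite /P CB => vC.
have [x Fx NF] := face_point faceF; have [y Gy NG] := face_point faceG.
have Px := face_sub faceF Fx; have Py := face_sub faceG Gy.
pose z := 2%:R^-1 *: (x + y).
have xyz : x + y = 2%:R *: z by rewrite scalerA divff ?scale1r // pnatr_eq0.
have za : P z by exact: hull_midpoint.
pose Q := P `&` reflection z P.
have yQ c : gen B c -> argmax Q c y.
  by rewrite -CB => cC; exact: (pair_cone_argmax Fx Gy xyz cC).
have feasible u : polar B u -> exists2 t, 0 < t & Q (y + t *: u).
  move=> uB; have [|t t0 tP] := pair_cone_feasible (u := u) NF NG Px Py.
    by move=> c; rewrite /P CB => /(polar_gen uB).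
  by exists t => //; exact: tP.
have sum_tight e w : argmax Q (\sum_j tight B e j) w ->
    forall j, dot (tight B e j) (w - y) = 0.
  move=> [wQ wmax].
  have tB j : gen B (tight B e j).
    by rewrite /tight; case: ifP => _; [exact: gen_elt | exact: gen0].
  have le j : 0 <= dot (tight B e j) y - dot (tight B e j) w.
    by rewrite subr_ge0; apply: (yQ _ (tB j)).2.
  move=> j; apply/eqP; rewrite -oppr_eq0 dotDr dotNr opprB; apply/eqP.
  apply: (@psumr_eq0P _ _ xpredT
    (fun j => dot (tight B e j) y - dot (tight B e j) w)) => //.
  apply/eqP; rewrite eq_le sumr_ge0 // andbT sumrB subr_le0 -!dot_suml.
  by apply: wmax; exact: (yQ _ (gen_sum tB)).1.
have argmax_sum e u t : (forall j, dot (tight B e j) u = 0) -> Q (y + t *: u) ->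
    argmax Q (\sum_j tight B e j) (y + t *: u).
  move=> uP uQ; split=> // w wQ.
  have Su : dot (\sum_j tight B e j) u = 0 by rewrite dot_suml big1.
  rewrite dotDr dotZr Su mulr0 addr0.
  apply: (yQ _ _).2 => //; apply: gen_sum => j.
  by rewrite /tight; case: ifP => _; [exact: gen_elt | exact: gen0].
have [[u [/eqP u0 uB]]|] := pselect (exists u, u <> 0 /\ forall j, dot (B j) u = 0).
- have [t t0 tQ] := feasible u (fun j => eq_ind_r (fun r => r <= 0) (lexx 0) (uB j)).
  (* For [e = 0] all generators count as tight, so maximizers of their sum agree with [y] on the
     whole cone. *)
  have tight_0 j : tight B 0 j = B j by rewrite /tight dot0r eqxx.
  pose c := \sum_j tight B 0 j.
  have cy : argmax Q c y.
    by apply: yQ; apply: gen_sum => j; rewrite tight_0; exact: gen_elt.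
  have cyu : argmax Q c (y + t *: u).
    by apply: argmax_sum => // j; rewrite tight_0.
  have [|E [p [q [edgeE Ec Ep Eq pq]]]] := section_edge za cy cyu.
    move=> /eqP; rewrite -subr_eq0 opprD addrA subrr add0r oppr_eq0.
    by rewrite scaler_eq0 gt_eqF // (negbTE u0).
  have Bpq j : dot (B j) (p - q) = 0.
    have := sum_tight _ _ (Ec _ Ep) j; have := sum_tight _ _ (Ec _ Eq) j.
    by rewrite tight_0 !dotE; lra.
  have Cpq c' : gen B c' -> dot c' (p - q) = 0.
    by move=> /gen_sub_mx/dot_gen_mx0; apply.
  have pq0 : p - q != 0 by rewrite subr_eq0; apply/eqP.
  exists (hyperplane (p - q)); last first.
    move=> d /(normal_vector_hyperplane pq0)[s _ ->] _ c' /Cpq.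
    by rewrite dotZr => ->; rewrite mulr0.
  split; first by exists z, (p - q); split => //; exists E, p, q.
  have hyp E' r : E' `<=` gen B -> relint E' r -> hyperplane (p - q) r.
    by move=> E'B [/E'B/Cpq]; rewrite /hyperplane /= dotC.
  (* A cone closed under negation is its own wall, proper because [p - q] is nonzero and orthogonal
     to it. Otherwise a [c'] whose opposite is missing yields an extreme ray of the polar, hence a
     facet. *)
  rewrite CB; have [lin|/existsNP[c' /not_implyP[c'B /farkasN[w wB wc']]]] :=
    pselect (forall c', gen B c' -> gen B (- c')).
    have [r rB] := relint_gen_nonempty B.
    exists (gen B); last by exists r; split => //; exact: hyp rB.
    right; split => // BT; have : gen B (p - q) by rewrite BT.
    by move=> /Cpq /eqP; rewrite dotxx_eq0 (negbTE pq0).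
  have [e [eB ce eb]] := extreme_ray wB wc'.
  have ext : extreme B e.
    split=> //; last by move=> b /eb bP; exists (dot (- c') b).
    apply: contrapT => /forallNP noi; move: ce; rewrite dotNl.
    rewrite (dot_gen_mx0 (gen_sub_mx c'B)) => [|j]; first by lra.
    by apply/eqP/negPn/negP/noi.
  exists (argmax (gen B) e); first by left; exact: facet_gen.
  have [r rB] := relint_gen_nonempty (tight B e).
  exists r; rewrite -argmax_gen // in rB; split => //; apply: hyp rB.
  by move=> ? [].
- move=> noL; have L0 u : (forall j, dot (B j) u = 0) -> u = 0.
    by move=> uB; apply: contrapT => u0; apply: noL; exists u.
  have [u uB vu] := farkasN vC.
  have [e [eB ve eb]] := extreme_ray uB vu.
  have e0 : e != 0 by apply/eqP => e0; move: ve; rewrite e0 dot0r; lra.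
  have ext : extreme B e.
    split=> //; last by move=> w /eb wP; exists (dot v w).
    apply: contrapT => /forallNP noi; move/eqP: e0; apply; apply: L0 => j.
    by apply/eqP/negPn/negP/noi.
  have {}eb w : (forall j, dot (B j) e = 0 -> dot (B j) w = 0) -> w = dot v w *: e.
    by move=> /eb/L0/eqP; rewrite subr_eq0 => /eqP.
  have [t t0 tQ] := feasible e eB.
  have te0 : t *: e != 0 by rewrite scaler_eq0 gt_eqF //= (negbTE e0).
  have tighte j : dot (tight B e j) e = 0.
    by move: j; apply/tight0.
  pose c := \sum_j tight B e j.
  (* The sum of the generators orthogonal to [e] is maximal exactly on the points of the section on
     the line through [y] along [e]; [y] itself is entered as [y + 0 *: e]. *)
  have edgeE : edge Q (argmax Q c).
    apply: (edge_argmax te0) => [||w /sum_tight/tight0/eb wE].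
    - by have := @argmax_sum e e 0 tighte; rewrite scale0r addr0; apply; exact: (yQ _ (gen0 B)).1.
    - exact: argmax_sum.
    - by exists (dot v (w - y) / t); rewrite scalerA divfK ?gt_eqF.
  exists (hyperplane (t *: e)); last first.
    move=> d /(normal_vector_hyperplane te0)[s _ ->].
    (* Since [dot v e = 1], positivity of [d] on [v] reads [0 < s * t]. *)
    rewrite scalerA dotZl dotC ve mulr1 => st c' /(polar_gen eB) c'e.
    by rewrite dotZr mulr_ge0_le0 // ltW.
  split.
    exists z, (t *: e); split => //; exists (argmax Q c), (y + t *: e), y; split => //.
    + exact: argmax_sum.
    + by have := @argmax_sum e e 0 tighte; rewrite scale0r addr0; apply; exact: (yQ _ (gen0 B)).1.
    + by move=> /eqP; rewrite -subr_eq0 addrAC subrr add0r (negbTE te0).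
    + by rewrite addrAC subrr add0r.
  rewrite CB; exists (argmax (gen B) e); first by left; exact: facet_gen.
  rewrite argmax_gen //; have [r rB] := relint_gen_nonempty (tight B e).
  exists r; split => //; rewrite /hyperplane /= dotZl dotC.
  by rewrite (dot_gen_mx0 (gen_sub_mx rB.1)) // mulr0.
Qed.

End Pair.

End Diagonal.

(** * The three conditions compared through membership of [v] in the pair cone *)

Theorem theorem1p26 (R : realType) (n : nat)
    (P : set 'rV[R]_n) (v : 'rV[R]_n)
    (polyP : polytope P) (orP : positively_oriented P v)
    (d : set 'rV[R]_n -> 'rV[R]_n)
    (dP : forall H, fundamental_arrangement P H ->
            normal_vector H (d H) /\ 0 < dot (d H) v)
    (F G : set 'rV[R]_n) (faceF : face P F) (faceG : face P G)
    (nF nG : set 'rV[R]_n -> 'rV[R]_n)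
    (nFP : forall E, facet P E -> F `<=` E -> outward_normal P E (nF E))
    (nGP : forall E, facet P E -> G `<=` E -> outward_normal P E (nG E)) :
  let sign_condition (H : set 'rV[R]_n) :=
    (exists E, [/\ facet P E, F `<=` E & dot (nF E) (d H) < 0]) \/
    (exists E, [/\ facet P E, G `<=` E & 0 < dot (nG E) (d H)]) in
  (in_im_diagonal P v F G <->
     (forall H, arrangement_at P F G H -> sign_condition H)) /\
  ((forall H, arrangement_at P F G H -> sign_condition H) <->
     (forall H, fundamental_arrangement P H -> sign_condition H)).
Proof.
move=> sign.
have [m [a PE]] := polytope_hull polyP; subst P.
have violate H : (forall c, pair_cone (hull a) F G c -> dot c (d H) <= 0) -> ~ sign H.
  move=> Hd [] [E [facetE subE]].
    have := Hd _ (pair_cone_l G (outward_normal_cone (nFP _ facetE subE) subE)).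
    by rewrite dotNl oppr_le0 leNgt => /negP.
  have := Hd _ (pair_cone_r F (outward_normal_cone (nGP _ facetE subE) subE)).
  by rewrite leNgt => /negP.
have im_all : pair_cone (hull a) F G v ->
    forall H, fundamental_arrangement (hull a) H -> sign H.
  move=> /(pair_coneP faceF faceG)[f [g [fN gN vE]]] H HP.
  have [nH dv] := dP _ HP.
  have [z [e [za [E [p [q [[[_ [c Ec]] _] Ep Eq pq eE]]]] HE]]] := HP.
  have [pa qa] : hull a p /\ hull a q.
    by move: Ep Eq; rewrite Ec => -[[? _] _] [[? _] _].
  have e0 : e != 0 by rewrite eE subr_eq0; apply/eqP.
  rewrite HE in nH; have [s _ dE] := normal_vector_hyperplane e0 nH; rewrite -HE in dE.
  have lin l : (forall p q, hull a p -> hull a q -> dot l p = dot l q) ->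
      dot l (d H) = 0.
    by move=> lP; rewrite dE eE dotZr dotDr dotNr (lP _ _ pa qa) subrr mulr0.
  have [gd|gd] := ltP 0 (dot g (d H)).
    have [E' [facetE' GE' E'P]] := facet_normal faceG gN lin gd.
    by right; exists E'; split => //; apply: E'P; exact: nGP.
  (* If [g] is not positive on [d H], positivity of [v = g - f] there makes [f] positive on
     [- d H]. *)
  have [||E' [facetE' FE' E'P]] := @facet_normal _ _ _ _ _ f (- d H) faceF fN.
  - by move=> l /lin; rewrite dotNr => ->; rewrite oppr0.
  - by move: dv; rewrite vE dotC dotDl dotNl dotNr; lra.
  left; exists E'; split => //.
  by have := E'P _ (nFP _ facetE' FE'); rewrite dotNr oppr_gt0.
have at_pair : (forall H, arrangement_at (hull a) F G H -> sign H) ->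
    pair_cone (hull a) F G v.
  move=> signP; apply: contrapT => /(violated_hyperplane faceF faceG)[H HP HdP].
  have [nH dv] := dP _ (proj1 HP).
  exact: (violate H (HdP _ nH dv) (signP _ HP)).
have imP := in_im_diagonalP faceF faceG orP.
split; split.
- by move=> im H [HP _]; apply: im_all => //; exact/imP.
- by move=> signP; exact/imP/at_pair.
- by move=> signP; exact/im_all/at_pair.
- by move=> signP H [HP _]; exact: signP.
Qed.
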